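(* Suppose that $\liminf_{i\to\infty}q_i>0$, and that the replacement distributions $\boldsymbol\alpha^{(k)}$ on $\{1,\dots,k\}$, $k\ge1$, are such that there exist constants $N_1,N_2\ge1$ and $a>0$, independent of $k$, with $\sum_{j=1}^{\min\{N_1,k\}}\alpha_j^{(k)}\ge a$ for all $k\ge N_2$, where $N_1$ is such that either (a) $\tilde q_j<1$ for all $j\in\{1,\dots,N_1\}$, or (b) $\tilde q_j=1$ for all $j\in\{1,\dots,N_1\}$ and there is a path from any $j\in\{1,\dots,N_1\}$ to every type in $\mathcal S$. Suppose also that there exists $B_1<\infty$ such that $\mathbf E_i(|\boldsymbol Z_1|^2)<B_1$ for all $i\ge1$. If $\{\boldsymbol\alpha^{(k)}\}$ is such that (i) there exists $B_2<\infty$ independent of $i,j,k$ such that $\bar v^{(k)}_j/\bar v^{(k)}_i<B_2$ whenever $\bar M^{(k)}_{ij}>0$, and (ii) there exists $i\ge1$ such that $\liminf_{k\to\infty}\left(\bar v^{(k)}_i/\sup_j\{\bar v^{(k)}_j\}\right)=b>0$, then $\liminf_{k\to\infty}\rho(\bar M^{(k)})>1$ implies $q_i<1$ (for the type $i$ in (ii)).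
   Context: $\{\boldsymbol Z_n\}_{n\ge0}$ is a multitype Galton–Watson branching process with countably infinite type set $\mathcal S=\{1,2,3,\dots\}$, started from a single individual whose type is denoted $\varphi_0$. Each individual lives one generation and, at death, independently of all other individuals, an individual of type $i$ produces $\boldsymbol r=(r_1,r_2,\dots)$ offspring ($r_j$ of type $j$, finitely many $r_j$ nonzero) with probability $p_i(\boldsymbol r)$. $Z_{n,j}$ is the number of type-$j$ individuals in generation $n$ and $|\boldsymbol Z_n|=\sum_jZ_{n,j}$. Write $\mathbf P_i(\cdot)=\mathbf P(\cdot\mid\varphi_0=i)$, $\mathbf E_i(\cdot)=\mathbf E(\cdot\mid\varphi_0=i)$. The mean progeny matrix is $M=(M_{ij})$, where $M_{ij}$ is the expected number of type-$j$ children of a type-$i$ parent; its row sums are assumed finite. There is a path from $i$ to $j$ if there is a directed path from $i$ to $j$ in the graph on $\mathcal S$ with an edge $u\to v$ if and only if $M_{uv}>0$. Global and partial extinction probabilities: $q_i=\mathbf P_i(\lim_n|\boldsymbol Z_n|=0)$ and $\tilde q_i=\mathbf P_i(\forall l\ge1:\lim_nZ_{n,l}=0)$. Given $k\ge1$ and a probability distribution $\boldsymbol\alpha^{(k)}=(\alpha^{(k)}_1,\dots,\alpha^{(k)}_k)$ on $\{1,\dots,k\}$, consider the branching process $\{\bar{\boldsymbol Z}^{(k)}_n\}$ in which types in $\{1,\dots,k\}$ have the same progeny distribution as in $\{\boldsymbol Z_n\}$, except that every individual of type larger than $k$ is instantaneously, and independently of everything else, replaced by an individual whose type is drawn from $\boldsymbol\alpha^{(k)}$.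 Its $k\times k$ mean progeny matrix is $\bar M^{(k)}=\tilde M^{(k)}+\boldsymbol x^{(k)}\boldsymbol\alpha^{(k)}$, where $\tilde M^{(k)}=(M_{ij})_{1\le i,j\le k}$, $\boldsymbol x^{(k)}$ is the $k\times1$ vector with $x^{(k)}_i=\sum_{j>k}M_{ij}$, and $\boldsymbol\alpha^{(k)}$ is a row vector. $\rho(\bar M^{(k)})$ is its Perron–Frobenius eigenvalue (spectral radius), and $\bar{\boldsymbol v}^{(k)}=(\bar v^{(k)}_1,\dots,\bar v^{(k)}_k)^\top$ is a right Perron–Frobenius eigenvector: $\bar M^{(k)}\bar{\boldsymbol v}^{(k)}=\rho(\bar M^{(k)})\bar{\boldsymbol v}^{(k)}$ with all entries strictly positive (assumed to exist). *)

(* Defs.v *)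
From HB Require Import structures.
From mathcomp Require Import all_boot all_order all_algebra.
From mathcomp Require Import finmap multiset complex.
From mathcomp Require Import all_classical all_reals all_analysis.

Set Implicit Arguments.
Unset Strict Implicit.
Unset Printing Implicit Defensive.
Import Order.TTheory GRing.Theory Num.Theory.
Import numFieldNormedType.Exports.

Local Open Scope mset_scope.
Local Open Scope classical_set_scope.
Local Open Scope ring_scope.

(* The type set {1, 2, 3, ...} is encoded by nat, with s : nat standing for the
   type s + 1: the types {1, ..., k} are the s < k, i.e. the ordinals of 'I_k.
   A population (in particular, the offspring of one individual) is a finite
   multiset r of types: r j is the number of individuals of type j in r, and
   size r is the total number of individuals. *)
Notation population := {mset nat}.

Section BranchingProcess.
Context {R : realType}.
Implicit Type p : nat -> population -> R.

(* p i r is the probability that an individual of type i has offspring r. *)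
Definition progeny_distribution p : Prop :=
  (forall i r, 0 <= p i r) /\
  (forall i, (\esum_(r in [set: population]) (p i r)%:E = 1)%E).

Definition mean_progeny p (i j : nat) : \bar R :=
  (\esum_(r in [set: population]) (p i r * (r j)%:R)%:E)%E.

(* The empty path is allowed, so there is always a path from i to i. *)
Definition type_path p (i j : nat) : Prop :=
  exists s : seq nat,
    path (fun u v => 0 < mean_progeny p u v)%E i s /\ last i s = j.

Context d (T : measurableType d) (P : probability T R).
(* xi n i m w is the offspring of the m-th individual of type i in
   generation n. *)
Implicit Type xi : nat -> nat -> nat -> T -> population.

(* As populations form a countable set, measurability, laws and mutual
   independence are expressed on the events {xi n i m = r}. *)
Definition offspring_family p xi : Prop :=
  [/\ forall n i m r, measurable [set w | xi n i m w = r],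
      forall n i m r, P [set w | xi n i m w = r] = (p i r)%:E
    & forall (J : {fset nat * nat * nat}) (r : nat * nat * nat -> population),
        P [set w | forall t, t \in J -> xi t.1.1 t.1.2 t.2 w = r t] =
        (\prod_(t <- J) P [set w | xi t.1.1 t.1.2 t.2 w = r t])%E].

(* Generation n of the process started from a single individual of type i0;
   the law P_i0 of the process conditioned on its initial type being i0 is the
   law of branching xi i0 under P. *)
Fixpoint branching xi (i0 n : nat) (w : T) : population :=
  if n is n'.+1 then
    let z := branching xi i0 n' w in
    \big[msetD/mset0]_(i <- finsupp z) \big[msetD/mset0]_(m < z i) xi n' i m w
  else [mset i0].

Definition global_extinction xi (i : nat) : \bar R :=
  P [set w | (fun n => (size (branching xi i n w))%:R : R) @ \oo --> (0 : R)].

Definition partial_extinction xi (i : nat) : \bar R :=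
  P [set w | forall l,
       (fun n => (branching xi i n w l)%:R : R) @ \oo --> (0 : R)].

End BranchingProcess.

Section ReplacedProcess.
Context {R : realType}.

Definition prob_vector k (alpha : 'rV[R]_k) : Prop :=
  (forall j, 0 <= alpha 0 j) /\ \sum_j alpha 0 j = 1.

(* Entries of the mean progeny matrix are extended reals; fine turns them into
   reals, which loses nothing when the row sums are finite. *)
Definition replaced_mean (p : nat -> population -> R) k (alpha : 'rV[R]_k) :
    'M[R]_k :=
  (\matrix_(i < k, j < k) fine (mean_progeny p i j)) +
  (\col_(i < k) fine (\sum_(k <= j <oo) mean_progeny p i j)%E) *m alpha.

Definition spectral_radius k (A : 'M[R]_k) : R :=
  sup [set ComplexField.Normc.normc l
      | l in [set l : R[i]%C | eigenvalue (map_mx (real_complex R) A) l]].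

Definition right_perron_vector k (A : 'M[R]_k) (v : 'cV[R]_k) : Prop :=
  A *m v = spectral_radius A *: v /\ forall i, 0 < v i 0.

(* v_i / sup_j v_j, with the dummy value 0 when type i is not one of the first
   k types. *)
Definition relative_entry k (v : 'cV[R]_k) (i : nat) : R :=
  if insub i is Some i' then v i' 0 / sup [set v j 0 | j in [set: 'I_k]]
  else 0.

End ReplacedProcess.

(* Main.v *)
Require Import Defs.
From HB Require Import structures.
From mathcomp Require Import all_boot all_order all_algebra.
From mathcomp Require Import finmap multiset complex.
From mathcomp Require Import all_classical all_reals all_analysis.
From mathcomp Require Import measurable_realfun ring lra zify.

Set Implicit Arguments.
Unset Strict Implicit.
Unset Printing Implicit Defensive.
Import Order.TTheory GRing.Theory Num.Theory.
Import numFieldNormedType.Exports.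

Local Open Scope classical_set_scope.
Local Open Scope ring_scope.

(* Fix k, let v be the Perron vector of the replaced process and m its largest
   entry.  Put tau_l = t v_l / m for types l among the first k, and
   tau_l = t (alpha v) / m for the other ones, so that the mean of the sum of
   tau over the offspring of j is rho tau_j.  By the second moment bound, by
   the bound on the ratios of entries of v and by
     prod (1 - tau_l) <= 1 - sum tau_l + (sum tau_l)^2,
   the expectation of the product of 1 - tau over the offspring of j is at
   most 1 - tau_j, for each of the first k types j, as soon as t is small; how
   small depends on a lower bound of rho - 1 but not on k.
   Hence the product of 1 - tau over generation n, killed as soon as a type
   beyond k shows up, is a supermartingale started from 1 - tau_i, and
   P_i(Z_n = 0, only the first k types ever appeared) <= 1 - tau_i
                                                     <= 1 - t b / 2.
   A realization of the process which goes extinct uses finitely many types,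
   so that letting n = k tend to infinity gives q_i <= 1 - t b / 2. *)

(** * Sums over countable types and countable partitions of events *)

Section CountableSums.
Context {R : realType}.
Local Open Scope ereal_scope.

(** Codes that name no element of [C] contribute the default 0, so the sum becomes a series over
    [nat], to which the theory of nonnegative series applies. *)
Lemma esum_countType (C : countType) (a : C -> \bar R) :
  (forall c, 0 <= a c) ->
  \esum_(c in [set: C]) a c = \sum_(0 <= n <oo) oapp a 0 (pickle_inv n).
Proof.
move=> a0; have b0 n : 0 <= oapp a 0 (pickle_inv n : option C).
  by case: pickle_inv.
rewrite nneseries_esumT //.
have -> : \esum_(c in [set: C]) a c =
    \esum_(c in [set: C]) oapp a 0 (pickle_inv (choice.pickle c)).
  by apply: eq_esum => c _; rewrite pickleK_inv.
have pickle_bij : set_bij [set: C] (range (@choice.pickle C)) choice.pickle.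
  by split=> // c c' _ _; apply: (pcan_inj (@pickleK_inv C)).
rewrite -(reindex_esum _ _ _ (fun n => oapp a 0 (pickle_inv n)) pickle_bij).
rewrite esum_mkcond; apply: eq_esum => n _.
case: ifPn => // /negP nS; case E : (pickle_inv n : option C) => [c|] //=.
by exfalso; apply: nS; rewrite inE; exists c => //; move: (@pickle_invK C n); rewrite E.
Qed.

Lemma esumZl (C : countType) (a : C -> \bar R) (x : R) : (0 <= x)%R ->
  (forall c, 0 <= a c) ->
  \esum_(c in [set: C]) (x%:E * a c) = x%:E * \esum_(c in [set: C]) a c.
Proof.
move=> x0 a0; rewrite !esum_countType //; last by move=> c; apply: mule_ge0.
rewrite -nneseriesZl; last by move=> n _; case: pickle_inv.
by apply: eq_eseriesr => n _; case: pickle_inv => //=; rewrite mule0.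
Qed.

Lemma exchange_esum (C D : countType) (a : C -> D -> \bar R) :
  (forall c e, 0 <= a c e) ->
  \esum_(c in [set: C]) \esum_(e in [set: D]) a c e =
  \esum_(e in [set: D]) \esum_(c in [set: C]) a c e.
Proof.
move=> a0.
have a0' c m : 0 <= oapp (a c) 0 (pickle_inv m : option D).
  by case: pickle_inv => [e|] //=.
rewrite (esum_countType (a := fun c => _)) => [|c]; last exact: esum_ge0.
rewrite [RHS](esum_countType (a := fun c => _)) => [|c]; last exact: esum_ge0.
pose b n m := oapp (fun c => oapp (a c) 0 (pickle_inv m : option D)) 0
  (pickle_inv n : option C).
transitivity (\sum_(0 <= n <oo) \sum_(0 <= m <oo) b n m).
  apply: eq_eseriesr => n _; rewrite /b; case: pickle_inv => [c|] /=.
    by rewrite esum_countType.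
  by rewrite eseries0.
rewrite nneseries_interchange; last by move=> n m; rewrite /b; case: (pickle_inv n) => [c|] //=.
apply: eq_eseriesr => m _; rewrite /b; case: (pickle_inv m) => [e|] /=.
  by rewrite esum_countType.
by rewrite eseries0 // => n _ _; case: pickle_inv.
Qed.

Context {d} {T : measurableType d} (mu : {measure set T -> \bar R}).

(** Populations carry no sigma-algebra here; events are cut along the countably many fibers of [X]
    instead. *)
Lemma measurable_fibers (C : countType) (X : T -> C) (A : set T) :
  (forall c, measurable (A `&` [set w | X w = c])) -> measurable A.
Proof.
move=> mA; have -> : A = \bigcup_c (A `&` [set w | X w = c]).
  by apply/seteqP; split=> [w Aw|w [c _ []]//]; exists (X w).
apply: countable_bigcupT_measurable => [|c].
  exact: countableP.
exact: mA.
Qed.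

Lemma measure_fibers (C : countType) (X : T -> C) (A : set T) :
  (forall c, measurable (A `&` [set w | X w = c])) ->
  mu A = \esum_(c in [set: C]) mu (A `&` [set w | X w = c]).
Proof.
move=> mA; rewrite esum_countType; last by move=> c.
pose F n := oapp (fun c => A `&` [set w | X w = c]) set0 (pickle_inv n : option C).
have mF n : measurable (F n).
  by rewrite /F; case: (pickle_inv n) => [c|] //=; exact: measurable0.
have {1}-> : A = \bigcup_n F n.
  apply/seteqP; split=> [w Aw|w [n _]].
    by exists (choice.pickle (X w)) => //; rewrite /F pickleK_inv.
  by rewrite /F; case: pickle_inv => [c []|].
rewrite measure_semi_bigcup.
- by apply: eq_eseriesr => n _; rewrite /F; case: pickle_inv => //=; rewrite measure0.
- exact: mF.
- apply/trivIsetP => n m _ _ nm; apply/seteqP; split=> // w [].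
  rewrite /F; have := @pickle_invK C m; have := @pickle_invK C n.
  case: (pickle_inv n) => // c; case: (pickle_inv m) => //= c' cn c'm.
  by move=> [_ /= cw] [_ /= c'w]; move: nm; rewrite -cn -c'm -cw -c'w eqxx.
- by apply: bigcup_measurable => n _; exact: mF.
Qed.

End CountableSums.

(** Lets the big operator lemmas for monoids flatten and reindex the sums of multisets in
    [branching]. *)
HB.instance Definition _ (K : choiceType) :=
  Monoid.isComLaw.Build {mset K}%mset mset0%mset (@msetD K)
    (@msetDA K) (@msetDC K) (@mset0D K).

(** * Independence of an event from offspring not yet revealed *)

Section Independence.
Context {R : realType} {d} {T : measurableType d} (P : probability T R).
Context (p : nat -> population -> R) (xi : nat -> nat -> nat -> T -> population).
Context (hxi : offspring_family P p xi).
Implicit Types (U : set (nat * nat * nat)) (t : nat * nat * nat).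
Local Open Scope ereal_scope.

Definition offspring t (w : T) : population := xi t.1.1 t.1.2 t.2 w.

(* A is independent of the offspring of the individuals indexed by U. *)
Definition indep_offspring (A : set T) (U : set (nat * nat * nat)) : Prop :=
  measurable A /\
  forall (J : {fset nat * nat * nat}) (r : nat * nat * nat -> population),
    (forall t, t \in J -> U t) ->
    P (A `&` [set w | forall t, t \in J -> offspring t w = r t]) =
    P A * (\prod_(t <- J) p t.1.2 (r t))%:E.

Lemma indep_offspringT U : indep_offspring setT U.
Proof.
split=> // J r _; rewrite setTI probability_setT mul1e.
have [_ h2 h3] := hxi; rewrite /offspring h3 -prodEFin.
by apply: eq_bigr => t _; rewrite h2.
Qed.

Lemma indep_offspring0 U : indep_offspring set0 U.
Proof. by split=> // J r _; rewrite set0I measure0 mul0e. Qed.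

Lemma indep_offspring_sub A U V :
  V `<=` U -> indep_offspring A U -> indep_offspring A V.
Proof. by move=> VU [mA hA]; split=> // J r JV; apply: hA => t /JV /VU. Qed.

(** Both sides of the product formula are countably additive in [A], so it may be checked on each
    fiber of [X]. *)
Lemma indep_offspring_fibers (C : countType) (X : T -> C) A U :
  (forall c, indep_offspring (A `&` [set w | X w = c]) U) -> indep_offspring A U.
Proof.
move=> hA; split; first by apply: (measurable_fibers (X := X)) => c; have [] := hA c.
move=> J r JU; set B := [set w | _].
have mB : measurable B.
  have [h1 _ _] := hxi.
  rewrite (_ : B = \bigcap_(t in [set` J]) [set w | offspring t w = r t]).
    by apply: fin_bigcap_measurable => // t _; exact: h1.
  by apply/seteqP; split=> w /= h t /h.
have hAX c : A `&` B `&` [set w | X w = c] = A `&` [set w | X w = c] `&` B.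
  by rewrite setIAC.
rewrite (measure_fibers P (X := X)) => [|c]; last first.
  by rewrite hAX; apply: measurableI => //; have [] := hA c.
rewrite [P A](measure_fibers P (X := X)) => [|c]; last by have [] := hA c.
transitivity (\esum_(c in [set: C])
    (\prod_(t <- J) p t.1.2 (r t))%:E * P (A `&` [set w | X w = c])).
  by apply: eq_esum => c _; rewrite hAX [RHS]muleC; exact: (hA c).2.
have [_ h2 _] := hxi.
have x0 : (0 <= \prod_(t <- J) p t.1.2 (r t))%R.
  by apply: prodr_ge0 => t _; rewrite -lee_fin -(h2 0%N t.1.2 0%N).
rewrite (esumZl x0) => [|c]; last exact: measure_ge0.
by rewrite muleC.
Qed.

Lemma indep_offspring1 A U t r : U t -> indep_offspring A U ->
  P (A `&` [set w | offspring t w = r]) = P A * (p t.1.2 r)%:E.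
Proof.
move=> Ut [_ hA].
have := hA [fset t]%fset (fun=> r); rewrite big_seq_fset1 => <-; last first.
  by move=> t'; rewrite inE => /eqP ->.
congr (P (_ `&` _)); apply/seteqP; split=> w /=.
  by move=> + t'; rewrite inE => + /eqP ->.
by apply; rewrite inE.
Qed.

(** Revealing the offspring of [t] leaves the rest of [U] fresh: the product formula for [A] is
    applied to [J] with [t] added. *)
Lemma indep_offspring_cons A U t r : U t -> indep_offspring A U ->
  indep_offspring (A `&` [set w | offspring t w = r]) (U `\ t).
Proof.
move=> Ut hA; have [mA hAJ] := hA; have [h1 _ _] := hxi; split.
  by apply: measurableI => //; exact: h1.
move=> J r' JU; rewrite (indep_offspring1 _ Ut hA) -muleA -EFinM.
have tJ : t \notin J by apply/negP => /JU [_]; apply.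
pose r2 t' := if t' == t then r else r' t'.
have r2t : r2 t = r by rewrite /r2 eqxx.
have := hAJ (t |` J)%fset r2; rewrite big_fsetU1 //= r2t.
rewrite (eq_big_seq (fun t => p t.1.2 (r' t))) => [<-|t' t'J]; last first.
  by rewrite /r2; case: eqP => // tt'; rewrite -tt' t'J in tJ.
- by move=> t'; rewrite !inE => /orP [/eqP ->//|/JU []].
- congr (P _); rewrite -setIA; congr (_ `&` _); apply/seteqP; split=> w /=.
    move=> [rt rJ] t'; rewrite !inE /r2; case: eqP => [->//|_] /=; exact: rJ.
  move=> rJ; split; first by rewrite (rJ t) ?fset1U1 // /r2 eqxx.
  move=> t' t'J; rewrite (rJ t') ?inE ?t'J ?orbT // /r2; case: eqP => // tt'.
  by rewrite -tt' t'J in tJ.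
Qed.

Definition total_offspring (L : seq (nat * nat * nat)) (w : T) : population :=
  (\big[msetD/mset0]_(t <- L) offspring t w)%mset.

(** Induction on [L], revealing one individual at a time; [r] accumulates the offspring already
    revealed. *)
Lemma indep_total_offspring A U L (r z : population) : uniq L ->
  (forall t, t \in L -> U t) -> indep_offspring A U ->
  indep_offspring (A `&` [set w | (r `+` total_offspring L w)%mset = z])
    (U `\` [set` L]).
Proof.
elim: L A U r => [|t L IH] A U r.
  move=> _ _ hA; apply: (indep_offspring_sub (U := U)); first exact: subDsetl.
  have [rz|rz] := eqVneq r z.
    rewrite (_ : _ `&` _ = A) //; apply/seteqP; split=> [w []//|w Aw]; split=> //=.
    by rewrite /total_offspring big_nil msetD0.
  rewrite (_ : _ `&` _ = set0); first exact: indep_offspring0.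
  apply/seteqP; split=> // w [_ /=].
  by rewrite /total_offspring big_nil msetD0 => /eqP; rewrite (negbTE rz).
move=> /= /andP[tL uL] LU hA.
apply: (indep_offspring_fibers (X := offspring t)) => s.
rewrite (_ : _ `&` _ = A `&` [set w | offspring t w = s] `&`
   [set w | ((r `+` s) `+` total_offspring L w)%mset = z]); last first.
  apply/seteqP; split=> w /= [].
    by move=> [Aw +] ws; rewrite /total_offspring big_cons ws msetDA.
  by move=> [Aw ws]; rewrite /total_offspring big_cons ws msetDA.
apply: indep_offspring_sub (IH _ (U `\ t) _ uL _ (indep_offspring_cons _ _ hA)).
- move=> t' [Ut']; rewrite /= inE => /negP; rewrite negb_or => /andP[/eqP tt' /negP t'L].
  by split.
- move=> t' t'L; split; first by apply: LU; rewrite inE t'L orbT.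
  by move=> /= tt'; rewrite -tt' t'L in tL.
- by apply: LU; rewrite mem_head.
Qed.

(** * Weights of populations and the killed process *)

Context (S : nat -> R) (k : nat).
Context (S0 : forall l, (0 <= S l)%R).
Context (p0 : forall i r, (0 <= p i r)%R).

(** The monomial S^z; its expectation over the offspring of a type is the generating function of
    that type at [S]. *)
Definition weight (z : population) : R := (\prod_(l <- z) S l)%R.

Lemma weight_ge0 z : (0 <= weight z)%R.
Proof. by apply: prodr_ge0. Qed.

Lemma weight0 : weight mset0 = 1%R.
Proof. by rewrite /weight big_mset0. Qed.

Lemma weightD z z' : weight (z `+` z')%mset = (weight z * weight z')%R.
Proof.
rewrite /weight -big_cat; apply: perm_big.
apply/allP => x _ /=; rewrite count_cat.
by rewrite !count_mem_mset msetE2.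
Qed.

(** [S] is a supersolution on the first [k] types: the offspring generating function at [S] does not
    exceed [S] there. *)
Context (Sk : forall l, (l < k)%N ->
  \esum_(r in [set: population]) (p l r * weight r)%:E <= (S l)%:E).

(** Distinct individuals reproduce independently, so the expected weight factorizes, and each factor
    is at most [S] at the type of the parent. *)
Lemma esum_weight_total_offspring A U L (r : population) : uniq L ->
  (forall t, t \in L -> U t) -> (forall t, t \in L -> (t.1.2 < k)%N) ->
  indep_offspring A U ->
  \esum_(z in [set: population])
    (weight z)%:E * P (A `&` [set w | (r `+` total_offspring L w)%mset = z]) <=
  (weight r * \prod_(t <- L) S t.1.2)%:E * P A.
Proof.
elim: L A U r => [|t L IH] A U r.
  move=> _ _ _ [mA _]; rewrite big_nil mulr1.
  rewrite (_ : esum _ _ = \esum_(z in [set r]) ((weight z)%:E * P A)).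
    by rewrite esum_set1 // mule_ge0 // lee_fin weight_ge0.
  rewrite [RHS]esum_mkcond; apply: eq_esum => z _; case: ifPn => [|/negP] zr.
    rewrite inE in zr; rewrite zr; congr (_ * P _); apply/seteqP.
    split=> [w []//|w Aw]; split=> //=.
    by rewrite /total_offspring big_nil msetD0.
  rewrite (_ : _ `&` _ = set0) ?measure0 ?mule0 //.
  apply/seteqP; split=> // w [_ /=]; rewrite /total_offspring big_nil msetD0 => rz.
  by apply: zr; rewrite inE.
move=> /= /andP[tL uL] LU Lk hA.
have Ut : U t by apply: LU; rewrite mem_head.
have LU' t' : t' \in L -> (U `\ t) t'.
  move=> t'L; split; first by apply: LU; rewrite inE t'L orbT.
  by move=> /= tt'; rewrite -tt' t'L in tL.
have hAt s := indep_offspring_cons s Ut hA.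
have split_t z s : A `&` [set w | (r `+` total_offspring (t :: L) w)%mset = z] `&`
    [set w | offspring t w = s] = A `&` [set w | offspring t w = s] `&`
   [set w | ((r `+` s) `+` total_offspring L w)%mset = z].
  apply/seteqP; split=> w /= [].
    by move=> [Aw +] ws; rewrite /total_offspring big_cons ws msetDA.
  by move=> [Aw ws]; rewrite /total_offspring big_cons ws msetDA.
rewrite (_ : esum _ _ = \esum_(z in [set: population]) \esum_(s in [set: population])
    (weight z)%:E * P (A `&` [set w | offspring t w = s] `&`
      [set w | ((r `+` s) `+` total_offspring L w)%mset = z])); last first.
  apply: eq_esum => z _; rewrite esumZl ?weight_ge0 //.
  rewrite (measure_fibers P (X := offspring t)) => [|s].
    by congr (_ * _); apply: eq_esum => s _; rewrite split_t.
  by rewrite split_t; have [] := indep_total_offspring (r `+` s)%mset z uL LU' (hAt s).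
(* Summing over [z] first, with the offspring [s] of [t] fixed, makes the induction hypothesis
   applicable. *)
rewrite exchange_esum => [|z s]; last by rewrite mule_ge0 // lee_fin weight_ge0.
have PAE : P A = (fine (P A))%:E by rewrite fineK // fin_num_measure //; case: hA.
set c := (weight r * \prod_(t' <- L) S t'.1.2 * fine (P A))%R.
have c0 : (0 <= c)%R.
  by rewrite !mulr_ge0 ?weight_ge0 ?prodr_ge0 // fine_ge0.
apply: (@le_trans _ _ (\esum_(s in [set: population])
   (c%:E * (p t.1.2 s * weight s)%:E))).
  apply: le_esum => s _.
  apply: le_trans (IH _ _ (r `+` s)%mset uL LU' _ (hAt s)) _.
    by move=> t' t'L; apply: Lk; rewrite inE t'L orbT.
  rewrite (indep_offspring1 _ Ut hA) PAE -!EFinM lee_fin weightD.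
  by rewrite le_eqVlt; apply/orP; left; apply/eqP; rewrite /c; ring.
rewrite esumZl //; last by move=> s; rewrite lee_fin mulr_ge0 ?weight_ge0.
rewrite big_cons PAE -EFinM.
apply: le_trans (lee_wpmul2l _ (Sk _)) _; rewrite ?lee_fin //.
  by apply: Lk; rewrite mem_head.
by rewrite /c le_eqVlt; apply/orP; left; apply/eqP; ring.
Qed.

(** Labels of the members of [z] in generation [n], matching the indices of [xi]; the nested sum of
    [branching] becomes a sum over distinct labels. *)
Definition individuals (n : nat) (z : population) : seq (nat * nat * nat) :=
  [seq (n, l, m) | l <- finsupp z, m <- iota 0 (z l)].

Lemma mem_individuals n z t :
  (t \in individuals n z) = (t.1.1 == n) && (t.2 < z t.1.2)%N.
Proof.
apply/allpairsPdep/andP => [[l [m [_ lm ->]]]|[/eqP tn tm]] /=.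
  by rewrite mem_iota add0n in lm.
exists t.1.2, t.2; split; last by rewrite -tn; case: (t) => [[]].
  by rewrite mem_finsupp; case: (z _) tm.
by rewrite mem_iota add0n.
Qed.

Lemma individuals_uniq n z : uniq (individuals n z).
Proof.
apply: allpairs_uniq_dep => // [l _|]; first exact: iota_uniq.
by move=> [l m] [l' m'] _ _ /= [-> ->].
Qed.

Lemma branchingS i n w : branching xi i n.+1 w =
  total_offspring (individuals n (branching xi i n w)) w.
Proof.
rewrite /total_offspring big_allpairs_dep /=.
apply: eq_bigr => l _; rewrite -[in RHS](subn0 (_ l)) big_mkord; exact: eq_bigr.
Qed.

Lemma prod_individuals n z : (\prod_(t <- individuals n z) S t.1.2 = weight z)%R.
Proof.
rewrite /weight big_allpairs_dep (@big_mset _ _ _ _ z).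
apply: eq_bigr => l _ /=; rewrite big_const_seq count_predT size_iota.
by rewrite Monoid.iteropE.
Qed.

(** The event that the process killed at the first type beyond the first [k] is still running in
    generation [n], with population [z]. *)
Definition truncated i n (z : population) : set T :=
  [set w | (forall m, (m <= n)%N -> all (fun l => l < k)%N (branching xi i m w)) /\
           branching xi i n w = z].

Lemma truncated0 i z : (i < k)%N ->
  truncated i 0 z = if z == [mset i]%mset then setT else set0.
Proof.
move=> ik; apply/seteqP; split=> w /=.
  by move=> [_ <-]; rewrite eqxx.
case: eqP => // -> _; split=> // m; rewrite leqn0 => /eqP -> /=.
by rewrite enum_msetn /= ik.
Qed.

Lemma truncatedS i n z' z : truncated i n.+1 z' `&` [set w | branching xi i n w = z] =
  if all (fun l => l < k)%N z' then
    truncated i n z `&` [set w | (mset0 `+` total_offspring (individuals n z) w)%mset = z']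
  else set0.
Proof.
apply/seteqP; split=> [w [[wk wz'] /= wz]|w].
  have := wk n.+1 (leqnn _); rewrite wz' => ->; split.
    by split=> // m mn; apply: wk; apply: leqW.
  by rewrite /= mset0D -wz -branchingS.
case: ifP => // z'k [[wk wz] /=]; rewrite mset0D => wz'.
have wS : branching xi i n.+1 w = z' by rewrite branchingS wz.
split=> //; split=> // m; rewrite leq_eqVlt => /orP[/eqP ->|]; first by rewrite wS.
by rewrite ltnS; apply: wk.
Qed.

(** Markov property: generations up to [n] are determined by the offspring of individuals of
    generations below [n]. *)
Lemma indep_truncated i n z : (i < k)%N ->
  indep_offspring (truncated i n z) [set t | (n <= t.1.1)%N].
Proof.
move=> ik; elim: n z => [|n IH] z.
  by rewrite truncated0 //; case: ifP => _; [exact: indep_offspringT|exact: indep_offspring0].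
apply: (indep_offspring_fibers (X := branching xi i n)) => z'.
rewrite truncatedS; case: ifP => _; last exact: indep_offspring0.
apply: indep_offspring_sub (indep_total_offspring _ _ (individuals_uniq n z') _ (IH z')).
- move=> t /= nt; split=> /=; first exact: ltnW.
  by rewrite mem_individuals => /andP[/eqP tn]; rewrite tn ltnn in nt.
- by move=> t; rewrite mem_individuals /= => /andP[/eqP -> _].
Qed.

(** Supermartingale property: the expected weight of the killed process does not increase from one
    generation to the next and starts from [S i]. *)
Lemma truncated_weight i n : (i < k)%N ->
  \esum_(z in [set: population]) (weight z)%:E * P (truncated i n z) <= (S i)%:E.
Proof.
move=> ik; elim: n => [|n IH].
  rewrite (_ : esum _ _ = \esum_(z in [set [mset i]%mset]) (weight z)%:E).
    by rewrite esum_set1 ?lee_fin ?weight_ge0 // /weight enum_msetn big_seq1.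
  rewrite [RHS]esum_mkcond; apply: eq_esum => z _.
  rewrite truncated0 //; case: ifPn => [/eqP ->|/eqP zi].
    by rewrite probability_setT mule1 mem_set.
  by rewrite measure0 mule0 memNset.
apply: le_trans IH.
have mt m z : measurable (truncated i m z) by have [] := indep_truncated m z ik.
have mf z z' : measurable (truncated i n.+1 z' `&` [set w | branching xi i n w = z]).
  rewrite truncatedS; case: ifP => // _.
  have [] // := indep_total_offspring mset0 z' (individuals_uniq n z) _
    (indep_truncated n z ik).
  by move=> t; rewrite mem_individuals /= => /andP[/eqP -> _].
rewrite (_ : esum _ _ = \esum_(z' in [set: population]) \esum_(z in [set: population])
    (weight z')%:E * P (truncated i n.+1 z' `&` [set w | branching xi i n w = z]));
    last first.
  apply: eq_esum => z' _; rewrite esumZl ?weight_ge0 //.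
  by rewrite (measure_fibers P (X := branching xi i n)).
rewrite exchange_esum => [|z' z]; last by rewrite mule_ge0 // lee_fin weight_ge0.
apply: le_esum => /= z _; change population in (type of z).
(* A population [z] with a type beyond the first [k] has already been killed and contributes 0. *)
have [zk|zk] := boolP (all (fun l => l < k)%N z); last first.
  rewrite esum1 // => [|z' _]; first by rewrite mule_ge0 // lee_fin weight_ge0.
  rewrite (_ : _ `&` _ = set0) ?measure0 ?mule0 //; apply/seteqP; split=> // w.
  by move=> [[wk _] /= wz]; move: zk; rewrite -wz wk.
rewrite -(prod_individuals n).
have Uk t : t \in individuals n z -> (t.1.2 < k)%N.
  rewrite mem_individuals => /andP[_ tz]; apply: (allP zk).
  by rewrite in_mset; case: (z _) tz.
have := @esum_weight_total_offspring _ _ _ mset0 (individuals_uniq n z) _ Uk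
  (indep_truncated n z ik).
rewrite weight0 mul1r => hw; apply: le_trans (hw _); last first.
  by move=> t; rewrite mem_individuals /= => /andP[/eqP -> _].
(* Killing in the new generation only drops nonnegative terms. *)
apply: le_esum => z' _; rewrite truncatedS; case: ifP => // _.
by rewrite measure0 mule0 mule_ge0 // lee_fin weight_ge0.
Qed.

(** The empty population has weight 1, so this probability is one term of the nonnegative sum
    bounded in [truncated_weight]. *)
Lemma truncated_extinction i n : (i < k)%N -> P (truncated i n mset0) <= (S i)%:E.
Proof.
move=> ik; apply: le_trans (truncated_weight n ik).
have W0 z : 0 <= (weight z)%:E * P (truncated i n z).
  by rewrite mule_ge0 // lee_fin weight_ge0.
rewrite (esumID [set mset0]) // setTI esum_set1 // weight0 mul1e.
by rewrite leeDl // esum_ge0.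
Qed.

End Independence.

(** * Extinction as a limit of truncated extinctions *)

Section GlobalExtinction.
Context {R : realType} {d} {T : measurableType d} (P : probability T R).
Context (p : nat -> population -> R) (xi : nat -> nat -> nat -> T -> population).
Context (hxi : offspring_family P p xi).

Lemma branching_extinct i n m w : (n <= m)%N ->
  branching xi i n w = mset0 -> branching xi i m w = mset0.
Proof.
move=> /subnK <- wn; elim: (m - n)%N => // {}m IH.
by rewrite addSn /= IH finsupp0 big_nil.
Qed.

(** A realization going extinct contains finitely many individuals, so its types are bounded. The
    index [n] is at once the generation and the truncation level. *)
Lemma extinct_truncated i w :
  ((fun n => (size (branching xi i n w))%:R : R) @ \oo --> (0 : R)) <->
  exists n0, forall n, (n0 <= n)%N -> truncated xi n i n mset0 w.
Proof.
split=> [/cvgrPdist_lt/(_ 1 ltr01)[N _ hN]|[n0 hn0]]; last first.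
  apply/cvgrPdist_lt => e e0; exists n0 => // n /= /hn0[_ ->].
  by rewrite enum_mset0 subrr normr0.
have wN : branching xi i N w = mset0.
  have := hN N (leqnn _); rewrite /= sub0r normrN normr_nat (ltr_nat R _ 1) ltnS leqn0.
  move=> /eqP/size0nil zN; apply/msetP => l.
  by rewrite -count_mem_mset zN mset0E.
(* The largest type seen up to generation [N], after which nobody lives; the bound on types is
   strict, whence [B.+1] below. *)
pose B := (\max_(m < N.+1) \max_(l <- branching xi i m w) l)%N.
exists (maxn N B.+1) => n; rewrite geq_max => /andP[Nn Bn]; split; last first.
  exact: branching_extinct wN.
move=> m _; have [mN|/ltnW mN] := leqP m N; last first.
  by rewrite (branching_extinct mN wN) enum_mset0.
apply/allP => l lm; apply: leq_trans Bn; rewrite ltnS.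
apply: leq_trans (leq_bigmax (Ordinal (mN : (m < N.+1)%N))).
exact: (leq_bigmax_seq (F := id)).
Qed.

(** For large [n] the truncated extinction events increase to global extinction, and continuity from
    below passes the bound to the limit. *)
Lemma global_extinction_le i (K : nat) (x : R) :
  (forall n, (K <= n)%N -> P (truncated xi n i n mset0) <= x%:E)%E ->
  (global_extinction P xi i <= x%:E)%E.
Proof.
(* The shift places every index above [i], where the events are measurable, and at least at [K],
   where [hx] applies. *)
move=> hx; pose F n := truncated xi (n + maxn K i.+1) i (n + maxn K i.+1) mset0.
have mF n : measurable (F n).
  have iN : (i < n + maxn K i.+1)%N by lia.
  by have [] := indep_truncated hxi (n + maxn K i.+1) mset0 iN.
have ndF : {homo F : n m / (n <= m)%N >-> (n <= m)%O}.
  move=> n m nm; apply/subsetPset => w [wk wz]; split; last first.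
    by apply: branching_extinct wz; lia.
  move=> l _; have [ln|nl] := leqP l (n + maxn K i.+1).
    by apply: sub_all (wk l ln) => ?; lia.
  by rewrite (branching_extinct (ltnW nl) wz) enum_mset0.
rewrite /global_extinction (_ : [set w | _] = \bigcup_n F n).
  have cF := @nondecreasing_cvg_mu _ _ _ P F mF (bigcup_measurable (fun k _ => mF k)) ndF.
  rewrite -(cvg_lim _ cF) //; apply: lime_le; first by apply/cvg_ex; eexists; exact: cF.
  by apply: nearW => n; apply: hx; lia.
apply/seteqP; split=> w /=.
  by move=> /extinct_truncated[n0 h]; exists n0 => //; apply: h; lia.
move=> [n0 _ wn]; apply/extinct_truncated; exists (n0 + maxn K i.+1)%N => n.
move=> nn; have -> : n = (n - maxn K i.+1 + maxn K i.+1)%N by lia.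
by have /subsetPset := ndF n0 (n - maxn K i.+1)%N ltac:(lia); apply.
Qed.

End GlobalExtinction.

(** * Second-order bound on the offspring generating function *)

Section OffspringGeneratingFunction.
Context {R : realType}.

(** Induction: with x the new entry and X the old sum, the induction hypothesis times 1 - x leaves
    the slack x X + x X^2 + x^2, which is nonnegative. *)
Lemma prod_onem_le (tau : nat -> R) (s : seq nat) : (forall l, 0 <= tau l <= 1) ->
  \prod_(l <- s) (1 - tau l) + \sum_(l <- s) tau l <= 1 + (\sum_(l <- s) tau l) ^+ 2.
Proof.
move=> tau01; elim: s => [|l s IH]; first by rewrite !big_nil expr0n /= !addr0.
rewrite !big_cons; have /andP[t0 t1] := tau01 l.
have : 0 <= \sum_(l <- s) tau l by apply: sumr_ge0 => m _; case/andP: (tau01 m).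
move: IH; set W := \prod_(_ <- _) _; set X := \sum_(_ <- _) _ => IH X0.
move: (tau l) t0 t1 => x x0 x1.
have h1 : (1 - x) * W <= (1 - x) * (1 + X ^+ 2 - X).
  by apply: ler_wpM2l; lra.
have h2 : 0 <= x * X by apply: mulr_ge0.
have h3 : 0 <= x * X ^+ 2 by rewrite mulr_ge0 ?sqr_ge0.
have h4 : 0 <= x ^+ 2 by apply: sqr_ge0.
nra.
Qed.

Local Open Scope ereal_scope.

Lemma esum_count (tau : nat -> R) (s : seq nat) : (forall l, 0 <= tau l)%R ->
  \esum_(l in [set: nat]) ((count_mem l s)%:R * tau l)%:E = (\sum_(l <- s) tau l)%:E.
Proof.
move=> tau0; elim: s => [|m s IH].
  by rewrite big_nil esum1 // => l _; rewrite mul0r.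
rewrite big_cons EFinD -IH -[X in X + _](@esum_set1 R _ m (fun l => (tau l)%:E)) ?lee_fin //.
rewrite [X in X + _]esum_mkcond -esumD.
- apply: eq_esum => l _; rewrite /= natrD mulrDl EFinD; congr (_ + _).
  case: ifPn => [|/negP]; rewrite inE => /= lm; first by rewrite lm eqxx mul1r.
  by case: eqP => [ml|]; rewrite ?mul0r //; rewrite ml in lm.
- by move=> l _; case: ifP => // _; rewrite lee_fin.
- by move=> l _; rewrite lee_fin mulr_ge0.
Qed.

Lemma mean_progeny_sum (p : nat -> population -> R) (tau : nat -> R) j :
  (forall r, 0 <= p j r)%R -> (forall l, 0 <= tau l)%R ->
  \sum_(0 <= l <oo) mean_progeny p j l * (tau l)%:E =
  \esum_(r in [set: population]) (p j r * \sum_(l <- (r : population)) tau l)%:E.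
Proof.
move=> p0 tau0.
have m0 l (r : population) : 0 <= (p j r * (r l)%:R)%:E by rewrite lee_fin mulr_ge0.
rewrite nneseries_esumT; last by move=> l; rewrite mule_ge0 ?esum_ge0 ?lee_fin.
transitivity (\esum_(l in [set: nat]) \esum_(r in [set: population])
    ((tau l)%:E * (p j r * (r l)%:R)%:E)).
  by apply: eq_esum => l _; rewrite esumZl // muleC.
rewrite exchange_esum; last by move=> l r; rewrite mule_ge0 // lee_fin.
apply: eq_esum => r _.
rewrite EFinM -esum_count // -esumZl // => [|l]; last by rewrite lee_fin mulr_ge0.
by apply: eq_esum => l _; rewrite count_mem_mset -!EFinM; congr _%:E; ring.
Qed.

(** With X the sum of [tau] over the offspring, the left side is at most 1 - E X + E X^2, where E X
    >= rho tau_j and E X^2 <= B1 B2^2 tau_j^2. The last hypothesis absorbs the quadratic term into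
    (rho - 1) tau_j. *)
Lemma offspring_generating_function_le (p : nat -> population -> R)
    (tau : nat -> R) j (rho B1 B2 : R) :
  (forall r, 0 <= p j r)%R ->
  \esum_(r in [set: population]) (p j r)%:E = 1 ->
  \esum_(r in [set: population]) (p j r * (size (r : population))%:R ^+ 2)%:E <= B1%:E ->
  (forall l, 0 <= tau l <= 1)%R ->
  (forall (r : population) l, (0 < p j r)%R -> l \in r -> tau l <= B2 * tau j)%R ->
  (rho * tau j)%:E <= \sum_(0 <= l <oo) mean_progeny p j l * (tau l)%:E ->
  (B1 * B2 ^+ 2 * tau j <= rho - 1)%R ->
  \esum_(r in [set: population]) (p j r * weight (fun l => 1 - tau l)%R r)%:E <=
  (1 - tau j)%:E.
Proof.
move=> p0 p1 hB1 tau01 hB2 hrho small.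
have tau0 l : (0 <= tau l)%R by case/andP: (tau01 l).
have W0 r : (0 <= weight (fun l => 1 - tau l) r)%R.
  by apply: weight_ge0 => l; rewrite subr_ge0; case/andP: (tau01 l).
pose X (r : population) := (\sum_(l <- r) tau l)%R.
have X0 r : (0 <= X r)%R by apply: sumr_ge0.
(* The ratio bound says nothing about offspring of probability zero, so the factor [p j r] is kept
   on both sides. *)
have XB r : (p j r * X r ^+ 2 <= p j r * ((B2 * tau j) ^+ 2 * (size r)%:R ^+ 2))%R.
  have := p0 r; rewrite le_eqVlt => /orP[/eqP <-|pr]; first by rewrite !mul0r.
  have XS : (X r <= B2 * tau j * (size r)%:R)%R.
    rewrite (_ : _ * _ = \sum_(l <- r) B2 * tau j)%R.
      by rewrite /X big_seq [leRHS]big_seq; apply: ler_sum => l; exact: hB2.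
    by rewrite big_const_seq count_predT iter_addr_0 mulr_natr.
  by rewrite ler_wpM2l // -exprMn ler_pXn2r ?nnegrE // (le_trans (X0 r) XS).
(* E X stays on the left so that only nonnegative terms are summed; the subtraction comes last, for
   the finite [rho * tau j]. *)
have total : \esum_(r in [set: population]) (p j r * weight (fun l => 1 - tau l)%R r)%:E +
    \esum_(r in [set: population]) (p j r * X r)%:E <=
    1 + (((B2 * tau j) ^+ 2)%:E * B1%:E).
  rewrite -esumD; first last.
  - by move=> r _; rewrite lee_fin mulr_ge0.
  - by move=> r _; rewrite lee_fin mulr_ge0.
  apply: (@le_trans _ _ (\esum_(r in [set: population])
     ((p j r)%:E + ((B2 * tau j) ^+ 2)%:E * (p j r * (size (r : population))%:R ^+ 2)%:E))).
    apply: le_esum => r _; rewrite -EFinM -!EFinD lee_fin.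
    have := ler_wpM2l (p0 r) (prod_onem_le (r : population) tau01); have := XB r.
    rewrite -/(X r) -/(weight (fun l => 1 - tau l)%R r); lra.
  rewrite esumD; first last.
  - by move=> r _; rewrite mule_ge0 // lee_fin ?sqr_ge0 ?mulr_ge0 ?sqr_ge0.
  - by move=> r _; rewrite lee_fin.
  rewrite p1 leeD2l // esumZl ?sqr_ge0 //; last first.
    by move=> r; rewrite lee_fin mulr_ge0 ?sqr_ge0.
  by rewrite lee_wpmul2l // lee_fin sqr_ge0.
rewrite -mean_progeny_sum // in total.
have {total} := le_trans (leeD2l _ hrho) total.
rewrite -leeBrDr // -EFinM -!EFinD => /le_trans; apply.
rewrite lee_fin; have := ler_wpM2r (tau0 j) small; nra.
Qed.

End OffspringGeneratingFunction.

(** * Translating the hypotheses: first generation, lower limits, expectations *)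

Lemma branching1 {d} {T : measurableType d} (xi : nat -> nat -> nat -> T -> population) i w :
  branching xi i 1 w = xi 0 i 0 w.
Proof.
rewrite /= finsupp_msetn /= big_seq_fset1 msetnxx.
by rewrite big_ord_recl big_ord0 msetD0.
Qed.

Lemma limn_einf_gt {R : realType} (u : (\bar R)^nat) (x : \bar R) :
  (x < limn_einf u)%E -> exists N, forall n, (N <= n)%N -> (x < u n)%E.
Proof.
rewrite limn_einf_lim (cvg_lim _ (@cvg_einfs_sup _ u)) // => /ereal_sup_gt[_ [N _ <-]] xN.
by exists N => n Nn; apply: lt_le_trans xN _; apply: ereal_inf_lbound; exists n.
Qed.

(** The function is a series of indicators of the fibers of [X] with nonnegative coefficients,
    integrated term by term. *)
Lemma expectation_countType {R : realType} d (T : measurableType d)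
    (P : probability T R) (C : countType) (X : T -> C) (f : C -> R) :
  (forall c, measurable [set w | X w = c]) -> (forall c, 0 <= f c) ->
  ('E_P[fun w => f (X w)] = \esum_(c in [set: C]) ((f c)%:E * P [set w | X w = c]))%E.
Proof.
move=> mX f0; rewrite unlock.
pose g n w : \bar R := oapp (fun c => (f c)%:E * (\1_[set w | X w = c] w)%:E)%E 0%E
  (pickle_inv n : option C).
have g0 n w : (0 <= g n w)%E.
  by rewrite /g; case: (pickle_inv n) => //= c; rewrite mule_ge0 // lee_fin.
transitivity (\int[P]_w \sum_(0 <= n <oo) g n w)%E.
  apply: eq_integral => w _.
  rewrite -(esum_countType (a := fun c => (f c)%:E * (\1_[set w | X w = c] w)%:E)%E).
    rewrite (esumID [set X w]) => [|c _]; last by rewrite mule_ge0 // lee_fin.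
    rewrite setTI esum_set1; last by rewrite mule_ge0 // lee_fin.
    rewrite indicE mem_set // mule1 esum1 ?adde0 // => c [_ /= cX].
    by rewrite indicE memNset ?mule0 // => /= Xc; apply: cX.
  by move=> c; rewrite mule_ge0 // lee_fin.
rewrite integral_nneseries //; last first.
  move=> n; rewrite /g; case: (pickle_inv n) => [c|] /=; last exact: measurable_cst.
  apply: measurable_funeM; apply/measurable_EFinP; exact: measurable_indic.
rewrite esum_countType; last by move=> c; rewrite mule_ge0 // lee_fin.
apply: eq_eseriesr => n _; rewrite /g; case: (pickle_inv n) => [c|] /=; last first.
  by rewrite integral0.
rewrite ge0_integralZl_EFin //.
- by rewrite integral_indic // setIT.
- by apply/measurable_EFinP; exact: measurable_indic.
Qed.

(** * The Perron vector extended to all types *)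

Section Replaced.
Context {R : realType} (p : nat -> population -> R).
Context (hp : progeny_distribution p).
Context (hM : forall u, (\sum_(0 <= j <oo) mean_progeny p u j < +oo)%E).
Context (k : nat) (alpha : 'rV[R]_k) (v : 'cV[R]_k).
Context (halpha : prob_vector alpha) (v0 : forall l, 0 < v l 0).

Let p0 u r : 0 <= p u r. Proof. by case: hp. Qed.

Lemma mean_progeny_ge0 u l : (0 <= mean_progeny p u l)%E.
Proof. by apply: esum_ge0 => r _; rewrite lee_fin mulr_ge0. Qed.

Lemma mean_progeny_tail_lty u n :
  (\sum_(n <= j <oo) mean_progeny p u j < +oo)%E.
Proof.
apply: le_lt_trans (hM u).
rewrite [leRHS](@nneseries_split _ _ 0 n) => [|l _]; last exact: mean_progeny_ge0.
by rewrite add0n leeDr // sume_ge0 // => l _; exact: mean_progeny_ge0.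
Qed.

Lemma mean_progeny_le_tail u n l : (n <= l)%N ->
  (mean_progeny p u l <= \sum_(n <= j <oo) mean_progeny p u j)%E.
Proof.
move=> nl; rewrite (@nneseries_split _ _ n (l.+1 - n)) => [|m _]; last exact: mean_progeny_ge0.
rewrite subnKC; last exact: leqW.
rewrite big_nat_recr //= -addeA addeC -addeA leeDl // adde_ge0 //.
  by apply: nneseries_ge0 => m _ _; exact: mean_progeny_ge0.
by apply: sume_ge0 => m _; exact: mean_progeny_ge0.
Qed.

Lemma mean_progeny_fin_num u l : mean_progeny p u l \is a fin_num.
Proof.
rewrite ge0_fin_numE ?mean_progeny_ge0 //.
exact: le_lt_trans (mean_progeny_le_tail u (leq0n l)) (hM u).
Qed.

(* Individuals of the types which are replaced get the mean of v under alpha. *)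
Definition extended_entry (l : nat) : R :=
  if insub l is Some l' then v l' 0 else \sum_m alpha 0 m * v m 0.

Lemma extended_entry_ge0 l : 0 <= extended_entry l.
Proof.
rewrite /extended_entry; case: insubP => [l' _ _|_]; first exact: ltW.
by apply: sumr_ge0 => m _; rewrite mulr_ge0 ?(ltW (v0 _)) //; case: halpha.
Qed.

Lemma extended_entry_le (B : R) : (forall l, v l 0 <= B) ->
  forall l, extended_entry l <= B.
Proof.
move=> vB l; rewrite /extended_entry; case: insubP => // _.
have [a0 a1] := halpha; rewrite -[B]mul1r -a1 mulr_suml.
by apply: ler_sum => m _; rewrite ler_wpM2l.
Qed.

(** All types from [k] on share one value, which factors out of the tail and leaves the rank-one
    term of [replaced_mean] applied to [v]. *)
Lemma mean_progeny_extended_entry (u : 'I_k) :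
  (\sum_(0 <= l <oo) mean_progeny p u l * (extended_entry l)%:E)%E =
  ((replaced_mean p alpha *m v) u 0)%:E.
Proof.
rewrite (@nneseries_split _ _ 0 k) => [|l _]; last first.
  by rewrite mule_ge0 ?mean_progeny_ge0 // lee_fin extended_entry_ge0.
rewrite add0n big_mkord.
rewrite (_ : (\sum_(k <= l <oo) _)%E = ((\sum_m alpha 0 m * v m 0)%:E *
   \sum_(k <= l <oo) mean_progeny p u l)%E); last first.
  rewrite -nneseriesZl => [|l _]; last exact: mean_progeny_ge0.
  rewrite eseries_cond [RHS]eseries_cond; apply: eq_eseriesr => l /= kl.
  by rewrite muleC /extended_entry insubF // ltnNge kl.
rewrite -[X in (_ + _ * X)%E]fineK; last first.
  rewrite ge0_fin_numE ?mean_progeny_tail_lty //.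
  by apply: nneseries_ge0 => l _ _; exact: mean_progeny_ge0.
rewrite (eq_bigr (fun l : 'I_k => (fine (mean_progeny p u l) * v l 0)%:E)); last first.
  move=> l _; rewrite EFinM fineK ?mean_progeny_fin_num // /extended_entry.
  by rewrite insubT //= => lk; congr (_ * (v _ 0)%:E)%E; apply: val_inj.
rewrite sumEFin -EFinM -EFinD; congr _%:E.
rewrite mxE mulrC mulr_sumr -big_split; apply: eq_bigr => l _ /=.
by rewrite !mxE big_ord_recl big_ord0 !mxE addr0 mulrDl mulrA.
Qed.

(** A type [l] occurring with positive probability has positive mean. For [l < k] this makes the
    matrix entry positive; otherwise the tail sum is positive, hence so is every entry charged by
    [alpha], and the ratio bound is averaged under [alpha]. *)
Lemma extended_entry_ratio (B2 : R) (u : 'I_k) (r : population) (l : nat) :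
  (forall w : 'I_k, 0 < replaced_mean p alpha u w -> v w 0 / v u 0 < B2) ->
  0 < p u r -> l \in r -> extended_entry l <= B2 * v u 0.
Proof.
move=> hB2 pr lr; have [a0 _] := halpha.
have Mul : (0 < mean_progeny p u l)%E.
  have pl (s : population) : (0 <= (p u s * (s l)%:R)%:E)%E by rewrite lee_fin mulr_ge0.
  rewrite /mean_progeny (esumID [set r]) // setTI esum_set1 //.
  apply: (@lt_le_trans _ _ (p u r * (r l)%:R)%:E).
    by rewrite lte_fin mulr_gt0 // ltr0n -in_mset.
  by rewrite leeDl // esum_ge0.
have hB w : 0 < replaced_mean p alpha u w -> v w 0 <= B2 * v u 0.
  by move=> /hB2; rewrite ltr_pdivrMr // => /ltW.
have x0 : 0 <= fine (\sum_(k <= j <oo) mean_progeny p u j)%E.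
  by rewrite fine_ge0 // nneseries_ge0 // => m _ _; exact: mean_progeny_ge0.
have entry w : replaced_mean p alpha u w = fine (mean_progeny p u w) +
    fine (\sum_(k <= j <oo) mean_progeny p u j)%E * alpha 0 w.
  by rewrite !mxE big_ord_recl big_ord0 !mxE addr0.
rewrite /extended_entry; case: insubP => [l' _ ll'|].
  apply: hB; rewrite entry; apply: ltr_wpDr; first by rewrite mulr_ge0.
  by rewrite ll' fine_gt0 // Mul -ge0_fin_numE ?mean_progeny_fin_num ?mean_progeny_ge0.
rewrite -leqNgt => kl.
have [_ a1] := halpha; rewrite -[B2 * _]mul1r -a1 mulr_suml.
apply: ler_sum => m _; have := a0 m; rewrite le_eqVlt => /orP[/eqP <-|am].
  by rewrite !mul0r.
rewrite ler_pM2l //; apply: hB; rewrite entry.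
apply: ltr_wpDl; first by rewrite fine_ge0 // mean_progeny_ge0.
rewrite mulr_gt0 // fine_gt0 // mean_progeny_tail_lty andbT.
exact: lt_le_trans Mul (mean_progeny_le_tail _ kl).
Qed.

End Replaced.

(** * Extinction bound at a fixed truncation level *)

Lemma relative_entry_ord {R : realType} k (v : 'cV[R]_k) (i : 'I_k) :
  relative_entry v i = v i 0 / sup [set v j 0 | j in [set: 'I_k]].
Proof. by rewrite /relative_entry valK. Qed.

Lemma entry_le_sup {R : realType} k (v : 'cV[R]_k) i :
  v i 0 <= sup [set v j 0 | j in [set: 'I_k]].
Proof.
apply: ub_le_sup; last by exists i.
exists (\sum_j `|v j 0|) => _ [j _ <-].
rewrite (bigD1 j) //=; apply: le_trans (ler_norm _) _.
by rewrite lerDl sumr_ge0.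
Qed.

(** The supersolution is [1 - tau], with [tau] proportional to the extended Perron vector. The
    matrix enters the condition on [t] only through its spectral radius, which is what makes a
    uniform [t] possible. *)
Lemma truncated_extinction_le {R : realType} d (T : measurableType d)
    (P : probability T R) (p : nat -> population -> R)
    (xi : nat -> nat -> nat -> T -> population)
    k (alpha : 'rV[R]_k) (v : 'cV[R]_k) (B1 B2 t : R) (i n : nat) :
  progeny_distribution p ->
  (forall u, (\sum_(0 <= j <oo) mean_progeny p u j < +oo)%E) ->
  offspring_family P p xi ->
  prob_vector alpha ->
  right_perron_vector (replaced_mean p alpha) v ->
  (forall u, (\esum_(r in [set: population])
    (p u r * (size (r : population))%:R ^+ 2)%:E <= B1%:E)%E) ->
  (forall u w : 'I_k, 0 < replaced_mean p alpha u w -> v w 0 / v u 0 < B2) ->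
  0 <= B1 -> 0 <= t <= 1 ->
  t * (B1 * B2 ^+ 2) <= spectral_radius (replaced_mean p alpha) - 1 ->
  (i < k)%N ->
  (P (truncated xi k i n mset0) <= (1 - t * relative_entry v i)%:E)%E.
Proof.
move=> hp hM hxi halpha [eigv v0] hB1 hB2 B10 /andP[t0 t1] small ik.
have p0 u r : 0 <= p u r by case: hp.
set rho := spectral_radius _ in eigv small.
pose m := sup [set v j 0 | j in [set: 'I_k]].
have vm l : v l 0 <= m by exact: entry_le_sup.
have m0 : 0 < m by apply: lt_le_trans (v0 (Ordinal ik)) (vm _).
(* Scaled so that [tau] is at most [t] and its value at [i] is [t * relative_entry v i]. *)
pose tau l := t / m * extended_entry alpha v l.
have tau01 l : 0 <= tau l <= 1.
  have e0 := extended_entry_ge0 halpha v0 l; have em := extended_entry_le halpha vm l.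
  rewrite /tau mulr_ge0 ?divr_ge0 ?(ltW m0) //=.
  rewrite mulrAC ler_pdivrMr // mul1r; apply: le_trans em.
  by rewrite ler_piMl.
have tauE (u : 'I_k) : tau u = t / m * v u 0 by rewrite /tau /extended_entry valK.
have taut l : tau l <= t.
  rewrite /tau mulrAC ler_pdivrMr //; apply: ler_wpM2l => //.
  exact: extended_entry_le.
have -> : 1 - t * relative_entry v i = 1 - tau i.
  rewrite (relative_entry_ord v (Ordinal ik)) (tauE (Ordinal ik)) -/m.
  by rewrite mulrA mulrAC.
apply: (truncated_extinction hxi (S := fun l => 1 - tau l)) => // [l|l lk].
  by rewrite subr_ge0; case/andP: (tau01 l).
apply: (offspring_generating_function_le (rho := rho) (B1 := B1) (B2 := B2)) => //.
- by case: hp.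
- move=> r l' pr l'r; rewrite (tauE (Ordinal lk)) /tau mulrCA.
  apply: ler_wpM2l; first by rewrite divr_ge0 ?(ltW m0).
  by apply: (extended_entry_ratio hp hM halpha v0 (u := Ordinal lk) _ pr l'r) => w; exact: hB2.
- rewrite (eq_eseriesr (g := fun l' => (t / m)%:E *
    (mean_progeny p l l' * (extended_entry alpha v l')%:E))%E) => [|l' _]; last first.
    by rewrite EFinM muleCA.
  rewrite nneseriesZl => [|l' _]; last first.
    by rewrite mule_ge0 ?mean_progeny_ge0 // lee_fin extended_entry_ge0.
  rewrite (mean_progeny_extended_entry hp hM halpha v0 (Ordinal lk)) eigv.
  by rewrite -EFinM lee_fin (tauE (Ordinal lk)) mxE mulrCA.
- apply: le_trans small; rewrite mulrC; apply: ler_wpM2r => //.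
  by rewrite mulr_ge0 ?sqr_ge0.
Qed.

(** * Uniform choice of the constants and passage to the limit *)

Theorem proposition1 (R : realType) (d : measure_display)
  (T : measurableType d) (P : probability T R)
  (p : nat -> population -> R)
  (xi : nat -> nat -> nat -> T -> population)
  (alpha : forall k : nat, 'rV[R]_k) (v : forall k : nat, 'cV[R]_k)
  (N1 N2 : nat) (a B1 B2 b : R) (i : nat)
  (hp : progeny_distribution p)
  (hM : forall u, (\sum_(0 <= j <oo) mean_progeny p u j < +oo)%E)
  (hxi : offspring_family P p xi)
  (halpha : forall k, (0 < k)%N -> prob_vector (alpha k))
  (hv : forall k, (0 < k)%N ->
     right_perron_vector (replaced_mean p (alpha k)) (v k))
  (hq : (0 < limn_einf (global_extinction P xi))%E)
  (hN1 : (1 <= N1)%N) (hN2 : (1 <= N2)%N) (ha : 0 < a)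
  (hmass : forall k, (0 < k)%N -> (N2 <= k)%N ->
     a <= \sum_(j < k | (j < minn N1 k)%N) alpha k 0 j)
  (hN1types :
     (forall j, (j < N1)%N -> (partial_extinction P xi j < 1)%E) \/
     ((forall j, (j < N1)%N -> partial_extinction P xi j = 1%E) /\
      (forall j, (j < N1)%N -> forall l, type_path p j l)))
  (hB1 : forall u,
     ('E_P[fun w => (((size (branching xi u 1 w))%:R ^+ 2)%R : R)] < B1%:E)%E)
  (hB2 : forall k (u w : 'I_k), 0 < replaced_mean p (alpha k) u w ->
     v k w 0 / v k u 0 < B2)
  (hb : 0 < b)
  (hlim : limn_einf (fun k => (relative_entry (v k) i)%:E) = b%:E) :
  (1 < limn_einf (fun k =>
         (spectral_radius (replaced_mean p (alpha k)))%:E))%E ->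
  (global_extinction P xi i < 1)%E.
Proof.
move=> hrho.
have [e e0 [K1 hK1]] : exists2 e : R, 0 < e & exists K, forall k, (K <= k)%N ->
    1 + e <= spectral_radius (replaced_mean p (alpha k)).
  have [e e0 he] : exists2 e : R, 0 < e & ((1 + e)%:E < limn_einf (fun k =>
      (spectral_radius (replaced_mean p (alpha k)))%:E))%E.
    (* A finite lower limit provides half of its excess over 1; for an infinite one any positive [e]
       would do. *)
    case: limn_einf hrho => [l||] //=; last by exists 1; rewrite ?ltry.
    rewrite lte_fin => l1; exists ((l - 1) / 2); first lra.
    by rewrite lte_fin; lra.
  exists e => //; have [K hK] := limn_einf_gt he; exists K => k /hK.
  by rewrite lte_fin => /ltW.
have [K2 hK2] : exists K, forall k, (K <= k)%N -> b / 2 <= relative_entry (v k) i.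
  have /limn_einf_gt[K hK] : ((b / 2)%:E < limn_einf (fun k =>
      (relative_entry (v k) i)%:E))%E by rewrite hlim lte_fin; lra.
  by exists K => k /hK; rewrite lte_fin => /ltW.
have hB1' u : (\esum_(r in [set: population])
    (p u r * (size (r : population))%:R ^+ 2)%:E <= B1%:E)%E.
  apply: le_trans (ltW (hB1 u)).
  have [mxi pxi _] := hxi.
  rewrite (_ : (fun w => _) = (fun w => (size (xi 0 u 0 w))%:R ^+ 2)); last first.
    by apply/funext => w; rewrite branching1.
  rewrite (expectation_countType P (X := xi 0%N u 0%N)
    (f := fun r : population => (size r)%:R ^+ 2)) //.
  by apply: le_esum => r _; rewrite pxi -EFinM mulrC.
have B10 : 0 <= B1.
  rewrite -lee_fin; apply: le_trans (hB1' 0%N); apply: esum_ge0 => r _.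
  by rewrite lee_fin mulr_ge0 //; case: hp.
pose C := B1 * B2 ^+ 2.
have C0 : 0 <= C by rewrite mulr_ge0 ?sqr_ge0.
(* The minimum with 1 gives [t <= 1]; [C + 1] avoids dividing by a [C] equal to 0. *)
pose t := Num.min 1 (e / (C + 1)).
have t0 : 0 < t by rewrite lt_min ltr01 divr_gt0 // ltr_wpDl.
have t1 : t <= 1 by rewrite ge_min lexx.
have tC : t * C <= e.
  apply: (@le_trans _ _ (e / (C + 1) * (C + 1))).
    apply: ler_pM => //; [exact: ltW| by rewrite ge_min lexx orbT|lra].
  by rewrite divfK // gt_eqF // ltr_wpDl.
apply: (@le_lt_trans _ _ (1 - t * (b / 2))%:E); last first.
  by rewrite lte_fin ltrBlDr ltrDl mulr_gt0 // divr_gt0.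
(* The same [n] is generation and truncation level, large enough to keep type [i] and to use both
   lower bounds [hK1] and [hK2]. *)
apply: (@global_extinction_le _ _ _ _ p _ hxi _ (maxn i.+1 (maxn K1 K2))) => n nK.
have n0 : (0 < n)%N by lia.
have nK1 : (K1 <= n)%N by lia.
have nK2 : (K2 <= n)%N by lia.
have ni : (i < n)%N by lia.
have := truncated_extinction_le (t := t) n hp hM hxi (halpha n n0) (hv n n0)
  hB1' (hB2 n) B10 _ _ ni.
move=> /(_ _ _)/le_trans; apply.
- by rewrite (ltW t0).
- by apply: le_trans tC _; have := hK1 n nK1; lra.
- by rewrite lee_fin lerB // ler_pM2l // hK2.
Qed.
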